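(* Let $c(x,y)=\|x-y\|^2$ on $\mathbb{R}^d\times\mathbb{R}^d$. Let $I_1,\dots,I_d\subseteq\mathbb{R}$ be (potentially unbounded) intervals, let $\Omega=I_1\times\cdots\times I_d\subseteq\mathbb{R}^d$, and let $\mathcal{Y}\subseteq\mathbb{R}^d$ be compact. Then for all $\rho\in\mathcal{P}_2(\mathbb{R}^d)$ satisfying $\operatorname{spt}\rho=\Omega\cap\varepsilon\mathbb{Z}^d$ for some $\varepsilon>0$, and all $\mu\in\mathcal{P}(\mathcal{Y})$, the set $\Phi_c(\rho,\mu)$ is non-empty and $$\operatorname{diam}_{L^\infty}(\Phi_c(\rho,\mu))\le C\varepsilon,\qquad\text{where } C=2d\operatorname{diam}(\mathcal{Y}).$$
   Context: $\mathcal{P}(\mathcal{Y})$ is the set of Borel probability measures on $\mathcal{Y}$, $\mathcal{P}_2(\mathbb{R}^d)$ those on $\mathbb{R}^d$ with finite second moment; $\operatorname{spt}$ is the support; $\operatorname{diam}(\mathcal{Y})$ is the Euclidean diameter. Dual optimal transport problem: maximise $\int\phi\,\mathrm{d}\rho+\int\psi\,\mathrm{d}\mu$ over $(\phi,\psi)\in L^1(\rho)\times L^1(\mu)$ (pointwise defined functions with values in $\mathbb{R}\cup\{-\infty\}$) subject to $\phi(x)+\psi(y)\le c(x,y)$ for all $(x,y)\in\mathbb{R}^d\times\mathbb{R}^d$. The set of $\rho$-side Kantorovich potentials is $$\Phi_c(\rho,\mu):=\{\phi\in L^1(\rho):\exists\,\psi\in L^1(\mu)\text{ with }(\phi,\psi)\text{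 optimal for the dual problem}\},$$ and $\operatorname{diam}_{L^\infty}(\Phi_c(\rho,\mu)):=\sup_{\phi_0,\phi_1\in\Phi_c(\rho,\mu)}\inf_{l\in\mathbb{R}}\|\phi_0-\phi_1-l\|_{L^\infty(\rho)}$. *)

(* Defs.v *)
From HB Require Import structures.
From mathcomp Require Import all_boot all_order all_algebra.
From mathcomp Require Import all_classical all_reals all_analysis.
Import Order.TTheory GRing.Theory Num.Theory.
Import numFieldNormedType.Exports.

Set Implicit Arguments.
Unset Strict Implicit.
Unset Printing Implicit Defensive.

Local Open Scope classical_set_scope.
Local Open Scope ring_scope.

(* R^d with its Borel sigma-algebra; the topology of 'rV[R]_d is the product
   topology, i.e. the Euclidean one. *)
Notation borelRd R d := (g_sigma_algebraType (@open 'rV[R]_d)).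

(* The norm `|x| that the library puts on row vectors is the sup norm. *)
Definition enorm (R : realType) (d : nat) (x : 'rV[R]_d) : R :=
  Num.sqrt (\sum_(i < d) x ord0 i ^+ 2).

Definition sqdist_cost (R : realType) (d : nat) (x y : borelRd R d) : R :=
  enorm ((x : 'rV[R]_d) - y) ^+ 2.

(* This is a real supremum: it is 0 (and not -oo, resp. +oo) when Y is empty
   or unbounded. *)
Definition ediam (R : realType) (d : nat) (Y : set 'rV[R]_d) : R :=
  sup [set enorm (p.1 - p.2) | p in Y `*` Y].

Definition box (R : realType) (d : nat) (I : 'I_d -> set R) : set 'rV[R]_d :=
  [set x | forall i, I i (x ord0 i)].

Definition scaled_lattice (R : realType) (d : nat) (eps : R) : set 'rV[R]_d :=
  [set eps *: map_mx intr z | z in [set: 'rV[int]_d]].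

Definition spt (R : realType) (d : nat) (rho : probability (borelRd R d) R) :
    set 'rV[R]_d :=
  [set x | forall U : set 'rV[R]_d, open_nbhs x U -> (0 < rho U)%E].

Definition finite_second_moment (R : realType) (d : nat)
    (rho : probability (borelRd R d) R) : Prop :=
  (\int[rho]_x (enorm (x : 'rV[R]_d) ^+ 2)%:E < +oo)%E.

(* Pointwise defined integrable functions with values in R `|` {-oo}. *)
Definition L1 (disp : measure_display) (T : measurableType disp)
    (R : realType) (mu : probability T R) : set (T -> \bar R) :=
  [set f | (forall x, f x < +oo)%E /\ mu.-integrable [set: T] f].

Section KantorovichDual.
Context (disp1 disp2 : measure_display) (T1 : measurableType disp1)
  (T2 : measurableType disp2) (R : realType).
Implicit Types (c : T1 -> T2 -> R) (rho : probability T1 R)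
  (mu : probability T2 R) (phi : T1 -> \bar R) (psi : T2 -> \bar R).

Definition dual_admissible c rho mu phi psi : Prop :=
  [/\ L1 rho phi, L1 mu psi
    & forall x y, (phi x + psi y <= (c x y)%:E)%E].

Definition dual_value rho mu phi psi : \bar R :=
  (\int[rho]_x phi x + \int[mu]_y psi y)%E.

Definition dual_optimal c rho mu phi psi : Prop :=
  dual_admissible c rho mu phi psi /\
  forall phi' psi', dual_admissible c rho mu phi' psi' ->
    (dual_value rho mu phi' psi' <= dual_value rho mu phi psi)%E.

Definition kantorovich_potentials c rho mu : set (T1 -> \bar R) :=
  [set phi | L1 rho phi /\
     exists psi, L1 mu psi /\ dual_optimal c rho mu phi psi].

End KantorovichDual.

(* The supremum and the infimum are taken in \bar R.  When phi0 and phi1 are in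
   L1 rho, the convention -oo - (-oo) = -oo matters on a rho-null set only. *)
Definition diam_Linfty (disp : measure_display) (T : measurableType disp)
    (R : realType) (rho : probability T R) (Phi : set (T -> \bar R)) : \bar R :=
  ereal_sup
    [set ereal_inf
           [set 'N[rho]_(+oo)[(fun x => p.1 x - p.2 x - l%:E)] | l in [set: R]]
     | p in Phi `*` Phi]%E.

(* Main.v *)
(* The points of the support are atoms.  At an atom [x], if no [y] in [Y] were
   nearly active at [x] for two optimal pairs simultaneously, then their
   midpoint could be raised at [x]; so both share a nearly active [y x].  For
   [f := phi0 - phi1] this gives, up to an arbitrarily small error,
     f x' - f x <= 2 * <x' - x, y x' - y x>.
   Along a lattice line in direction [e_i] the right-hand sides telescope to
   [2 * eps * (y x' - y x)_i <= 2 * eps * diam Y], whatever the length of the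
   line, and any two points of the box are joined by [d] such lines.

   Existence of a potential: transforms bring any admissible pair into a
   pointwise bounded class; Tychonoff's theorem and the countability of the
   support give a maximising sequence converging on the support, and dominated
   convergence and Fatou's lemma pass to the limit. *)
Require Import Defs.
From HB Require Import structures.
From mathcomp Require Import all_boot all_order all_algebra.
From mathcomp Require Import all_classical all_reals all_analysis.
From mathcomp Require Import measurable_realfun ess_sup_inf zify ring lra.

Set Implicit Arguments.
Unset Strict Implicit.
Unset Printing Implicit Defensive.

Import Order.TTheory GRing.Theory Num.Theory.
Import numFieldNormedType.Exports.

Local Open Scope classical_set_scope.
Local Open Scope ring_scope.

(** * Compactness and measure-theoretic preliminaries *)

(** Tychonoff's theorem gives the nested sets [A n] a cluster point [u] in the product of the
    intervals [[- b x, b x]]. Since [T] may be uncountable, no sequence need converge to [u] at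
    every point. Being close to [u] at the first [n] points of [e] defines a neighbourhood, so [v n]
    can be taken in [A n] within [n.+1%:R^-1] of [u] there. *)
Lemma bounded_cluster_sequence (T : eqType) (R : realType) (e : nat -> T)
    (b : T -> R) (A : nat -> set (T -> R)) :
  (forall n, A n !=set0) -> (forall n, A n.+1 `<=` A n) ->
  (forall n u, A n u -> forall x, `|u x| <= b x) ->
  exists u : T -> R, (forall x, `|u x| <= b x) /\
    exists v : nat -> T -> R, (forall n, A n (v n)) /\
      forall k, v n (e k) @[n --> \oo] --> u (e k).
Proof.
move=> A0 AS Ab.
have Ale m n : (m <= n)%N -> A n `<=` A m.
  elim: n => [|n IH]; first by rewrite leqn0 => /eqP ->.
  by rewrite leq_eqVlt ltnS => /predU1P[->//|/IH mn] w /AS /mn.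
have FA : ProperFilter (filter_from setT A).
  apply: filter_from_proper => //; apply: filter_from_filter; first by exists 0%N.
  move=> i j _ _; exists (maxn i j) => // w Aw.
  by split; apply: Ale Aw; rewrite ?leq_maxl ?leq_maxr.
have := @tychonoff T (fun=> R : topologicalType) (fun x => `[- b x, b x]%classic)
  (fun x => segment_compact (a := - b x) (b := b x)).
move=> /(_ (filter_from setT A) FA)[].
  by exists 0%N => // w Aw x; rewrite /= in_itv /= -ler_norml; exact: Ab Aw x.
move=> u [ub clu]; exists u; split.
  by move=> x; rewrite ler_norml; have := ub x; rewrite /= in_itv.
pose K := fun _ : T => R : topologicalType.
have nbx x r : 0 < r -> nbhs (u : prod_topology K) [set w | `|u x - w x| < r].
  move=> r0; have := @proj_continuous T K x u (ball (u x) r) (nbhsx_ballx _ _ r0).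
  exact.
have nbk m r : 0 < r ->
    nbhs (u : prod_topology K)
      [set w | forall k, (k < m)%N -> `|u (e k) - w (e k)| < r].
  move=> r0; elim: m => [|m IH]; first by apply: filterS filterT.
  apply: filterS (filterI IH (nbx (e m) _ r0)) => w [wk wm] k.
  by rewrite ltnS leq_eqVlt => /predU1P[->//|/wk].
have nbu n : exists w : T -> R, A n w /\
    forall k, (k < n)%N -> `|u (e k) - w (e k)| < n.+1%:R^-1.
  have r0 : 0 < n.+1%:R^-1 :> R by rewrite invr_gt0 ltr0n.
  have An : filter_from setT A (A n) by exists n.
  by have [w [? ?]] := clu _ _ An (nbk n _ r0); exists w.
have [v Hv] := choice nbu.
exists v; split => [n|k]; first exact: (Hv n).1.
apply/cvgrPdist_lt => eps eps0; near=> n.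
apply: lt_trans (_ : n.+1%:R^-1 < eps); first by apply: (Hv n).2; near: n; exact: nbhs_infty_gt.
by near: n; exact: (near_infty_natSinv_lt (PosNum eps0)).
Unshelve. all: by end_near. Qed.

(** Every subset of [S] is countable, hence measurable, so [g] may be arbitrary on [S]. *)
Lemma measurable_fun_cst_off_countable (disp disp' : measure_display)
    (T : measurableType disp) (U : measurableType disp') (S : set T) (g : T -> U)
    (r : U) :
  (forall x : T, measurable [set x]) -> countable S ->
  (forall x, ~ S x -> g x = r) -> measurable_fun [set: T] g.
Proof.
move=> m1 cS gr _ B mB; rewrite setTI.
have mSB (A : set T) : measurable (S `&` A).
  apply: countable_measurable => //.
  by apply: sub_countable cS; apply: subset_card_le => x [].
have mS : measurable S by rewrite -[S]setIT; exact: mSB.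
rewrite -[_ @^-1` _](setUIDK _ S) setIC setDE.
apply: measurableU; first exact: mSB.
have [Br|Br] := pselect (B r).
- rewrite (_ : _ `&` _ = ~` S); first exact: measurableC.
  by apply/seteqP; split => [x []//|x Sx]; split => //=; rewrite gr.
- rewrite (_ : _ `&` _ = set0)//.
  by apply/seteqP; split => // x [] /= + Sx; rewrite gr.
Qed.

Lemma ae_exists (disp : measure_display) (T : measurableType disp)
    (R : realType) (mu : {measure set T -> \bar R}) (A : set T) (Q : T -> Prop) :
  measurable A -> (0 < mu A)%E -> {ae mu, forall x, Q x} ->
  exists2 x, A x & Q x.
Proof.
move=> mA A0 [N [mN N0 QN]]; apply: contrapT => nQ.
suff : (mu A <= mu N)%E by rewrite N0 leNgt A0.
apply: le_measure; rewrite ?inE// => x Ax; apply: QN => /= Qx.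
by apply: nQ; exists x.
Qed.

Section full_measure.
Context (disp : measure_display) (T : measurableType disp) (R : realType)
  (P : probability T R) (A : set T).
Hypotheses (mA : measurable A) (PA : P A = 1%E).

Let PC : P (~` A) = 0%E.
Proof. by rewrite probability_setC// PA subee. Qed.

Let ACC : [set: T] `\` ~` A = A.
Proof. by rewrite setTD setCK. Qed.

Lemma integrable_full (f : T -> \bar R) : measurable_fun [set: T] f ->
  P.-integrable A f -> P.-integrable [set: T] f.
Proof.
move=> mf fA; apply/(negligible_integrable (measurableC mA) measurableT mf PC).
by rewrite ACC.
Qed.

Lemma integral_full (f : T -> \bar R) : P.-integrable [set: T] f ->
  (\int[P]_x f x = \int[P]_(x in A) f x)%E.
Proof.
move=> fi; rewrite (negligible_integral (measurableC mA) measurableT fi PC).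
by rewrite ACC.
Qed.

Lemma integrable_cst_full (k : R) : P.-integrable A (cst k%:E).
Proof. exact: (finite_measure_integrable_cst P k mA). Qed.

Lemma integral_cst_full (k : R) : (\int[P]_(x in A) cst k%:E x = k%:E)%E.
Proof.
have PA1 : (P : {measure set T -> \bar R}) A = 1%E := PA.
by rewrite integral_cst// PA1 mule1.
Qed.

Lemma ae_full (Q : T -> Prop) :
  (forall x, A x -> Q x) -> {ae P, forall x, Q x}.
Proof.
move=> AQ; exists (~` A); split => //; first exact: measurableC.
by move=> x /= nQ /AQ.
Qed.

End full_measure.

(** An integrable function is finite almost everywhere, and an atom cannot lie in the exceptional
    null set. *)
Lemma L1_atom_fin_num (disp : measure_display) (T : measurableType disp)
    (R : realType) (P : probability T R) (f : T -> \bar R) (x : T) :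
  measurable [set x] -> (0 < P [set x])%E -> L1 P f -> f x \is a fin_num.
Proof.
move=> mx Px [_ /(integrable_ae measurableT) fi].
by have [_ -> /(_ Logic.I)] := ae_exists mx Px fi.
Qed.

Lemma le_limn_einf (R : realType) (u v : (\bar R)^nat) :
  (forall n, (u n <= v n)%E) -> (limn_einf u <= limn_einf v)%E.
Proof.
move=> uv; rewrite !limn_einf_lim; apply: lee_lim; try exact: is_cvg_einfs.
apply: nearW => n; apply: le_ereal_inf_tmp => _ [k nk <-].
by apply: ge_ereal_inf; exists (u k) => //; exists k.
Qed.

(** * Existence of an optimal pair when [rho] is carried by a countable set *)

Section dual_attainment.
Context (d1 d2 : measure_display) (T1 : measurableType d1)
  (T2 : measurableType d2) (R : realType).
Variables (rho : probability T1 R) (mu : probability T2 R) (c : T1 -> T2 -> R)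
  (a : T1 -> R) (Y : set T2) (e : nat -> T1) (x0 : T1).
Let S := range e.
Hypotheses (m1 : forall x : T1, measurable [set x]) (rhoS : rho S = 1%E)
  (Sx0 : S x0) (rhox0 : (0 < rho [set x0])%E)
  (mY : measurable Y) (muY : mu Y = 1%E)
  (mc : forall x, measurable_fun [set: T2] (c x))
  (c0 : forall x y, 0 <= c x y) (ca : forall x y, Y y -> c x y <= a x)
  (ia : rho.-integrable [set: T1] (EFin \o a)).

Let cS : countable S.
Proof. exact: card_image_le. Qed.

Let mS : measurable S.
Proof. exact: countable_measurable. Qed.

Let Y0 : Y !=set0.
Proof.
by apply/set0P/eqP => Y0; move: muY; rewrite Y0 measure0 => /eqP; rewrite eq_sym onee_eq0.
Qed.

Let a0 x : 0 <= a x.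
Proof. by have [y Yy] := Y0; exact: le_trans (c0 x y) (ca _ Yy). Qed.

(** [b] bounds a c-transform normalised to vanish at [x0], because [c x y - c x' y <= a x + a x'].
    [B] is chosen so that [ctr u + B] is nonnegative on [Y], by testing the supremum at [x0]. *)
Let b x := a x + a x0.
Let B := a x0 + b x0.

(** The value -oo off [S] voids the dual constraint there and changes [pot u] only on a null set. *)
Let pot (u : T1 -> R) (x : T1) : \bar R := if x \in S then (u x)%:E else -oo%E.

(* The opposite of the c-transform of [pot u]. *)
Let ctr (u : T1 -> R) (y : T2) : \bar R :=
  ereal_sup [set (u x - c x y)%:E | x in S].

Let mpot u : measurable_fun [set: T1] (pot u).
Proof.
apply: (measurable_fun_cst_off_countable (r := -oo%E) m1 cS) => x Sx.
by rewrite /pot memNset.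
Qed.

Let mctr u : measurable_fun [set: T2] (ctr u).
Proof.
have -> : ctr u = fun y => esups (fun n => (u (e n) - c (e n) y)%:E) 0%N.
  apply/funext => y; congr ereal_sup; apply/seteqP; split => z.
    by move=> [_ [n _ <-] <-]; exists n.
  by move=> [n _ <-]; exists (e n) => //; exists n.
apply: measurable_fun_esups => n; apply/measurable_EFinP.
exact: measurable_funB.
Qed.

Let ib : rho.-integrable [set: T1] (EFin \o b).
Proof.
rewrite (_ : _ \o _ = (EFin \o a) \+ cst (a x0)%:E)%E; last first.
  by apply/funext => x /=; rewrite EFinD.
by apply: integrableD => //; apply: finite_measure_integrable_cst.
Qed.

Let class : set (T1 -> R) := [set u | forall x, `|u x| <= b x].

Let pot_le u x : class u -> S x -> (`|pot u x| <= (b x)%:E)%E.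
Proof. by move=> ub Sx; rewrite /pot mem_set//= lee_fin. Qed.

Let ipot u : class u -> rho.-integrable S (pot u).
Proof.
move=> ub; apply: (@le_integrable _ _ _ rho S mS _ (EFin \o b)).
- exact: measurable_funTS.
- by move=> x Sx; rewrite /= (le_trans (pot_le ub Sx))// lee_fin ler_norm.
- exact: (integrableS measurableT).
Qed.

Let ctr_ge u y : class u -> Y y -> ((- B)%:E <= ctr u y)%E.
Proof.
move=> ub Yy; apply: le_trans (_ : (u x0 - c x0 y)%:E <= _)%E; last first.
  by apply: ereal_sup_ubound; exists x0.
rewrite lee_fin; have := ub x0; have := ca x0 Yy.
by rewrite ler_norml /B => ? /andP[? ?]; lra.
Qed.

Let F u : \bar R := (\int[rho]_(x in S) pot u x)%E.
(** The shift by [B] makes the integrand nonnegative on [Y]: the integral makes sense, possibly as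
    +oo, before [ctr u] is known to be integrable, and Fatou's lemma applies. *)
Let G u : \bar R := (\int[mu]_(y in Y) (ctr u y + B%:E))%E.

Let mG u : measurable_fun Y (fun y => (ctr u y + B%:E)%E).
Proof. by apply: emeasurable_funD => //; exact: measurable_funTS. Qed.

Let G_ge0 u y : class u -> Y y -> (0 <= ctr u y + B%:E)%E.
Proof.
move=> ub Yy; have := ctr_ge ub Yy; case: (ctr u y) => [r| |]//=.
  by rewrite -EFinD !lee_fin; lra.
by rewrite addye ?leey.
Qed.

Let F_fin u : class u -> F u \is a fin_num.
Proof. by move=> ub; apply: integrable_fin_num => //; exact: ipot. Qed.

(* Replacing [phi] by the double transform of [psi] (and normalising it at
   [x0]) does not decrease the dual value and lands in [class]. *)
Let improve phi psi : dual_admissible c rho mu phi psi ->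
  exists2 u, class u & (dual_value rho mu phi psi + G u <= B%:E + F u)%E.
Proof.
move=> [L1phi L1psi adm]; have [_ iphi] := L1phi; have [psioo ipsi] := L1psi.
have phi0 : phi x0 \is a fin_num by exact: L1_atom_fin_num L1phi.
(* Where [psi] is -oo the constraint is void, so the transform [v] below is a real infimum over
   [Y']. *)
pose Y' := [set y | Y y /\ psi y \is a fin_num].
have [y1 Yy1 psiy1] : exists2 y, Y y & psi y \is a fin_num.
  have muY0 : (0 < mu Y)%E by rewrite muY lte01.
  have [y Yy /(_ Logic.I)] := ae_exists mY muY0 (integrable_ae measurableT ipsi).
  by exists y.
pose E x := [set c x y - fine (psi y) | y in Y'].
have E0 x : E x !=set0 by exists (c x y1 - fine (psi y1)), y1.
have cb x x' y : Y y -> c x y - c x' y <= a x + a x'.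
  by move=> Yy; have := ca x Yy; have := c0 x' y; have := a0 x'; lra.
(* Admissibility at [x0], where [phi] is finite, bounds [E x0] below; the bounded variation of the
   cost in [x] carries this to every [E x]. *)
have E0lb : lbound (E x0) (fine (phi x0)).
  move=> _ [y [Yy psiy] <-]; have := adm x0 y.
  by rewrite -(fineK phi0) -(fineK psiy) -EFinD lee_fin lerBrDr.
have Elb x : has_lbound (E x).
  exists (fine (phi x0) - b x) => _ [y [Yy psiy] <-].
  have : fine (phi x0) <= c x0 y - fine (psi y) by apply: E0lb; exists y.
  by rewrite /b; have := cb x0 x y Yy; lra.
pose v x := inf (E x).
have vb x x' : v x <= v x' + (a x + a x').
  rewrite -lerBlDr; apply: lb_le_inf => // _ [y [Yy psiy] <-].
  have : v x <= c x y - fine (psi y) by apply: ge_inf => //; exists y.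
  by have := cb x x' y Yy; lra.
pose u x := v x - v x0.
have ub : class u.
  move=> x; rewrite ler_norml /u /b; have := vb x x0; have := vb x0 x; lra.
exists u => //.
set p := (\int[rho]_x phi x)%E; set q := (\int[mu]_y psi y)%E.
have pfin : p \is a fin_num by exact: integrable_fin_num.
have qfin : q \is a fin_num by exact: integrable_fin_num.
(* On [S], [phi <= v], and [v] is [pot u] shifted by [v x0]. *)
have Hp : (p <= F u + (v x0)%:E)%E.
  rewrite /p (integral_full mS rhoS)//.
  have <- : (\int[rho]_(x in S) (pot u x + cst (v x0)%:E x) = F u + (v x0)%:E)%E.
    by rewrite (integralD mS (ipot ub) (integrable_cst_full _ mS _))
      (integral_cst_full mS rhoS).
  apply: le_integral => //; first exact: (integrableS measurableT).
    by apply: integrableD => //; [exact: ipot|exact: integrable_cst_full].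
  move=> x; rewrite inE => Sx; rewrite /pot mem_set//= -EFinD /u subrK.
  have := L1phi.1 x; case phix : (phi x) => [r| |]// _; last by rewrite leNye.
  rewrite lee_fin; apply: lb_le_inf => // _ [y [Yy psiy] <-].
  by have := adm x y; rewrite phix -(fineK psiy) -EFinD lee_fin lerBrDr.
(* From [v x + psi y <= c x y] it follows that [ctr u <= - v x0 - psi] on [Y]; the shift by [v x0]
   cancels against the one in [Hp]. *)
have Hq : (G u <= (B - v x0)%:E - q)%E.
  rewrite /q (integral_full mY muY)//.
  have iY := integrableS measurableT mY (@subsetT _ Y) ipsi.
  have <- : (\int[mu]_(y in Y) (cst (B - v x0)%:E y - psi y) =
      (B - v x0)%:E - \int[mu]_(y in Y) psi y)%E.
    by rewrite (integralB mY (integrable_cst_full _ mY _) iY)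
      (integral_cst_full mY muY).
  have le y : Y y -> (ctr u y + B%:E <= (B - v x0)%:E - psi y)%E.
    move=> Yy; have := psioo y; case psiy : (psi y) => [r| |]// _; last first.
      by rewrite /= addey// leey.
    suff H : (ctr u y <= (- v x0 - r)%:E)%E.
      by apply: le_trans (leeD2r B%:E H) _; rewrite -EFinB -EFinD lee_fin; lra.
    apply: ge_ereal_sup => _ [x _ <-]; rewrite lee_fin /u.
    have : v x <= c x y - r; last by lra.
    by apply: ge_inf => //; exists y; rewrite /Y' /= ?psiy.
  apply: ge0_le_integral => //.
  - by move=> y Yy; exact: G_ge0.
  - by apply: emeasurable_funB => //; exact: measurable_int iY.
have Ffin := F_fin ub.
rewrite /dual_value -/p -/q.
move: Hp Hq; rewrite -(fineK pfin) -(fineK qfin) -(fineK Ffin).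
move: (v x0) (fine (F u)) (fine p) (fine q) => w r s t.
case: (G u) => [g| |]//=; last by rewrite !leNye.
by rewrite -?EFinB -?EFinD !lee_fin; lra.
Qed.


Let zero_admissible : dual_admissible c rho mu (cst 0%E) (cst 0%E).
Proof.
split; [by split=> [x|]; [exact: ltry|exact: integrable0]..|].
by move=> x y; rewrite adde0 lee_fin.
Qed.

Let F_bound u : class u -> (F u <= \int[rho]_x (b x)%:E)%E.
Proof.
move=> ub; rewrite (integral_full mS rhoS)//.
apply: le_integral => //; [exact: ipot|exact: (integrableS measurableT)|].
by move=> x; rewrite inE => Sx; exact: le_trans (lee_abs _) (pot_le ub Sx).
Qed.

(* [B - E u] is the dual value of [pot u] and its c-transform. *)
Let E u : \bar R := (G u - F u)%E.
Let m : \bar R := ereal_inf [set E u | u in class].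

(** Improving the zero pair, admissible since [c] is nonnegative, bounds [m] above; [G u >= 0] and
    the domination of [F u] by the integral of [b] bound it below. *)
Let m_fin : m \is a fin_num.
Proof.
rewrite fin_numElt; apply/andP; split; last first.
  have [u ub] := improve zero_admissible.
  rewrite /dual_value !integral0 !add0e => H.
  apply: (@le_lt_trans _ _ (E u)); first by apply: ereal_inf_lbound; exists u.
  move: H; rewrite /E -(fineK (F_fin ub)).
  by case: (G u) => [g| |]//= _; exact: ltry.
have bfin : (\int[rho]_x (b x)%:E)%E \is a fin_num by exact: integrable_fin_num.
apply: lt_le_trans (_ : (- \int[rho]_x (b x)%:E)%E <= _)%E.
  by rewrite -(fineK bfin) -EFinN ltNye.
apply: le_ereal_inf_tmp => _ [u ub <-]; rewrite /E.
apply: le_trans (_ : (0 - F u <= _))%E.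
  by rewrite sub0e leeN2 F_bound.
by apply: leeB => //; apply: integral_ge0 => y Yy; exact: G_ge0.
Qed.

(** Direct method on the sets of near-minimisers. Along the sequence [F] converges, while [G] is
    only lower semicontinuous, which is the direction needed to minimise [G - F]. *)
Let attained : exists2 u, class u & (G u <= m + F u)%E.
Proof.
pose A n : set (T1 -> R) := [set u | class u /\ (E u <= m + (n.+1%:R^-1)%:E)%E].
have A0 n : A n !=set0.
  have n0 : 0 < n.+1%:R^-1 :> R by rewrite invr_gt0 ltr0n.
  have [_ [u ub <-] um] := lb_ereal_inf_adherent n0 m_fin.
  by exists u; split => //; exact: ltW.
have AS n : A n.+1 `<=` A n.
  move=> u [ub um]; split => //; apply: le_trans um _; rewrite leeD2l// lee_fin.
  by rewrite lef_pV2 ?posrE ?ltr0n// ler_nat.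
have [u [ub [v [Av vu]]]] := bounded_cluster_sequence e A0 AS (fun n u Au => Au.1).
exists u => //.
have vS x : S x -> v n x @[n --> \oo] --> u x by move=> [k _ <-].
have Fv : F (v n) @[n --> \oo] --> F u.
  have [] := @dominated_convergence _ _ _ rho S mS (fun n => pot (v n)) (pot u) (EFin \o b).
  - by move=> n; exact: measurable_funTS.
  - exact: measurable_funTS.
  - apply: aeW => x Sx; rewrite /pot mem_set//=.
    by apply: cvg_EFin; [exact: nearW|exact: vS].
  - exact: (integrableS measurableT).
  - by apply: aeW => x n Sx; apply: pot_le => //; exact: (Av n).1.
  - by [].
(* [ctr] is a supremum of expressions that converge along [v n], hence lower semicontinuous. *)
have ctrv y : Y y ->
    (ctr u y + B%:E <= limn_einf (fun n => ctr (v n) y + B%:E))%E.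
  move=> Yy; rewrite -leeBrDr//; apply: ge_ereal_sup => _ [x Sx <-].
  rewrite leeBrDr// -EFinD.
  have H : ((v n x - c x y) + B)%:E @[n --> \oo] --> ((u x - c x y) + B)%:E.
    apply: cvg_EFin; first exact: nearW.
    by apply: cvgD; [apply: cvgB; [exact: vS|exact: cvg_cst]|exact: cvg_cst].
  rewrite -(cvg_limn_einf_sup H).1; apply: le_limn_einf => n.
  by rewrite EFinD leeD2r//; apply: ereal_sup_ubound; exists x.
have Gu : (G u <= limn_einf (fun n => G (v n)))%E.
  apply: le_trans (fatou mu mY (fun n => mG (v n)) _); last first.
    by move=> n y Yy; apply: G_ge0 => //; exact: (Av n).1.
  apply: ge0_le_integral => //; first by move=> y; exact: G_ge0.
  apply: (measurableT_comp (f := -%E)) => //.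
  apply: (measurable_fun_limn_esup (f := fun n y => - (ctr (v n) y + B%:E))%E) => n.
  exact: (measurableT_comp (f := -%E)).
apply: (le_trans Gu).
have H : (m + (n.+1%:R^-1)%:E + F (v n))%E @[n --> \oo] --> (m + 0%:E + F u)%E.
  have := F_fin ub; move: Fv => /[swap] /fineK <-; rewrite -(fineK m_fin).
  move=> Fv; apply: cvgeD => //; apply: cvgeD => //; first exact: cvg_cst.
  by apply: cvg_EFin; [exact: nearW|exact: cvg_harmonic].
rewrite adde0 in H; rewrite -(cvg_limn_einf_sup H).1.
apply: le_limn_einf => n; have [vb] := Av n; rewrite /E.
by rewrite leeBlDr// F_fin.
Qed.

(** Finiteness of [G u] at the minimiser makes [ctr u] integrable, so [pot u] and [- ctr u] form an
    admissible pair of value at least [B - m]. By [improve], any admissible pair has value at most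
    [B - E w] for some [w] in [class], hence at most [B - m]. *)
Lemma kantorovich_potentials_nonempty :
  kantorovich_potentials c rho mu !=set0.
Proof.
have [u ub Gu] := attained.
have Ffin := F_fin ub.
have Gfin : G u \is a fin_num.
  rewrite ge0_fin_numE; last by apply: integral_ge0 => y; exact: G_ge0.
  by apply: le_lt_trans Gu _; rewrite -(fineK Ffin) -(fineK m_fin) -EFinD ltry.
have ictrB : mu.-integrable Y (fun y => ctr u y + B%:E)%E.
  apply/integrableP; split => //.
  rewrite (eq_integral (fun y => ctr u y + B%:E)%E).
    by rewrite -/(G u) -(fineK Gfin) ltry.
  by move=> y; rewrite inE => Yy; rewrite gee0_abs// G_ge0.
have ictrY : mu.-integrable Y (ctr u).
  have := integrableB mY ictrB (integrable_cst_full mu mY B).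
  by apply: eq_integrable => // y _ /=; rewrite addeK.
have ictr := integrable_full mY muY (mctr u) ictrY.
have GE : (G u = \int[mu]_y ctr u y + B%:E)%E.
  rewrite /G (integralD mY ictrY (integrable_cst_full mu mY B)).
  by rewrite (integral_cst_full mY muY) (integral_full mY muY).
have L1pot : L1 rho (pot u).
  split; last exact: integrable_full (ipot ub).
  by move=> x; rewrite /pot; case: ifP; rewrite ?ltry.
have L1ctr : L1 mu (fun y => - ctr u y)%E.
  split; last exact: integrableN.
  move=> y; rewrite lteNl; apply: lt_le_trans (_ : (u x0 - c x0 y)%:E <= _)%E.
    by rewrite ltNyr.
  by apply: ereal_sup_ubound; exists x0.
have adm : dual_admissible c rho mu (pot u) (fun y => - ctr u y)%E.
  split => // x y; rewrite /pot; case: ifPn => [|_]; last by rewrite addNye leNye.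
  rewrite inE => Sx; have : ((u x - c x y)%:E <= ctr u y)%E.
    by apply: ereal_sup_ubound; exists x.
  case: (ctr u y) => [r| |]//=; last by rewrite addeNy leNye.
  by rewrite -EFinB !lee_fin; lra.
exists (pot u); split => //; exists (fun y => - ctr u y)%E; split => //.
split => // phi psi adm'; have [w wb] := improve adm'.
have [[_ iphi] [_ ipsi] _] := adm'.
have : (m <= E w)%E by apply: ereal_inf_lbound; exists w.
have pfin := integrable_fin_num measurableT iphi.
have qfin := integrable_fin_num measurableT ipsi.
have Wfin := F_fin wb.
have Cfin := integrable_fin_num measurableT ictr.
move: Gu; rewrite /E /dual_value GE.
rewrite integralN; last exact: integrable_add_def.
rewrite (integral_full mS rhoS L1pot.2) -/(F u).
move: pfin qfin Wfin Cfin Ffin m_fin => /fineK <- /fineK <- /fineK <- /fineK <- /fineK <- /fineK <-.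
case: (G w) => [g| |]; rewrite -?EFinB -?EFinD ?lee_fin//.
move: (fine _) (fine _) (fine _) (fine _) (fine _) (fine _) => *; lra.
Qed.

End dual_attainment.

(** * Nearly active points shared by two optimal pairs *)

(** Serves the admissibility of a midpoint raised by [t]: with +oo excluded, any infinite entry
    makes the left side -oo. *)
Lemma half_sum_le (R : realType) (a0 a1 b0 b1 : \bar R) (r0 r1 t : R) :
  (a0 < +oo)%E -> (a1 < +oo)%E -> (b0 < +oo)%E -> (b1 < +oo)%E ->
  (a0 + b0 <= r0%:E)%E -> (a1 + b1 <= r1%:E)%E ->
  (2^-1%:E * (a0 + a1) + t%:E + 2^-1%:E * (b0 + b1) <= ((r0 + r1) / 2 + t)%:E)%E.
Proof.
have Ny : ((2^-1)%:E * -oo = -oo :> \bar R)%E by rewrite gt0_muleNy ?lte_fin ?invr_gt0.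
case: a0 a1 b0 b1 => [a0| |] [a1| |] [b0| |] [b1| |]//=;
  rewrite ?(Ny, addeNy, addNye, leNye)// => _ _ _ _.
by rewrite -?EFinD -?EFinM -?EFinD !lee_fin; lra.
Qed.

Section approximate_contact.
Context (d1 d2 : measure_display) (T1 : measurableType d1)
  (T2 : measurableType d2) (R : realType).
Variables (rho : probability T1 R) (mu : probability T2 R) (c : T1 -> T2 -> R)
  (Y : set T2).
Hypotheses (mY : measurable Y) (muY : mu Y = 1%E).
Variables (phi0 phi1 : T1 -> \bar R) (psi0 psi1 : T2 -> \bar R).
Hypotheses (opt0 : dual_optimal c rho mu phi0 psi0)
  (opt1 : dual_optimal c rho mu phi1 psi1).

(* Otherwise the midpoint of the two pairs, raised by [del / 2] at the atom
   [x] and cut off outside [Y], would have a larger dual value. *)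
Lemma approximate_contact (x : T1) (del : R) :
  measurable [set x] -> (0 < rho [set x])%E -> 0 < del ->
  exists y, [/\ Y y, ((c x y - del)%:E <= phi0 x + psi0 y)%E
    & ((c x y - del)%:E <= phi1 x + psi1 y)%E].
Proof.
move=> mx rx del0; apply: contrapT => nex.
have [[Lphi0 Lpsi0 adm0] max0] := opt0.
have [[Lphi1 Lpsi1 adm1] max1] := opt1.
have [phi0y iphi0] := Lphi0; have [psi0y ipsi0] := Lpsi0.
have [phi1y iphi1] := Lphi1; have [psi1y ipsi1] := Lpsi1.
pose phi z := (2^-1%:E * (phi0 z + phi1 z) + (del / 2 * \1_[set x] z)%:E)%E.
pose half y := (2^-1%:E * (psi0 y + psi1 y))%E.
(* The assumption [nex] only concerns points of [Y]; elsewhere the value -oo makes the constraint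
   trivial. *)
pose psi y := if y \in Y then half y else -oo%E.
have iphi : rho.-integrable [set: T1] (fun z => 2^-1%:E * (phi0 z + phi1 z))%E.
  by apply: integrableZl => //; exact: integrableD.
have ihalf : mu.-integrable [set: T2] half.
  by apply: integrableZl => //; exact: integrableD.
have iind : rho.-integrable [set: T1] (fun z => (del / 2 * \1_[set x] z)%:E).
  apply: (@eq_integrable _ _ _ rho _ measurableT
      (fun z => (del / 2)%:E * (\1_[set x] z)%:E)%E) => //.
  by apply: integrableZl => //; exact: integrable_indic.
have mpsi : measurable_fun [set: T2] psi.
  apply: measurable_fun_ifT; [|exact: measurable_int ihalf|by []].
  by apply: (measurable_fun_bool true); rewrite setTI (_ : _ @^-1` _ = Y)//;
    apply/seteqP; split => y; [exact: set_mem|exact: mem_set].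
have psiE : {in Y, half =1 psi} by move=> y yY; rewrite /psi yY.
have ipsi : mu.-integrable [set: T2] psi.
  apply: (integrable_full mY muY mpsi); apply: (@eq_integrable _ _ _ mu _ mY half psi psiE).
  exact: (integrableS measurableT).
have Lphi : L1 rho phi.
  split; last exact: integrableD.
  move=> z; rewrite /phi lte_add_pinfty ?ltry//.
  by move: (phi0y z) (phi1y z); case: (phi0 z) (phi1 z) => [?| |] [?| |]//= _ _;
    rewrite ?addeNy ?addNye ?gt0_muleNy ?lte_fin ?invr_gt0// ltry.
have Lpsi : L1 mu psi.
  split => // y; rewrite /psi; case: ifP => // _; rewrite /half.
  by move: (psi0y y) (psi1y y); case: (psi0 y) (psi1 y) => [?| |] [?| |]//= _ _;
    rewrite ?addeNy ?addNye ?gt0_muleNy ?lte_fin ?invr_gt0// ltry.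
have adm : dual_admissible c rho mu phi psi.
  split => // z y; rewrite /psi; case: ifPn => [|_]; last first.
    by rewrite addeNy leNye.
  rewrite inE => Yy; rewrite /phi /half.
  have [zx|zx] := pselect (z = x); last first.
    rewrite indicE memNset// mulr0 (_ : c z y = (c z y + c z y) / 2 + 0)//; last lra.
    exact: half_sum_le.
  rewrite zx indicE mem_set// mulr1.
  (* At [x] one of the two pairs has slack at least [del], so their average has slack at least
     [del / 2], the amount of the raise. *)
  have [ge0|lt0] := leP (c x y - del)%:E (phi0 x + psi0 y)%E.
    have [ge1|lt1] := leP (c x y - del)%:E (phi1 x + psi1 y)%E.
      by exfalso; apply: nex; exists y.
    rewrite (_ : c x y = (c x y + (c x y - del)) / 2 + del / 2)//; last lra.
    by apply: half_sum_le => //; exact: ltW.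
  rewrite (_ : c x y = ((c x y - del) + c x y) / 2 + del / 2)//; last lra.
  by apply: half_sum_le => //; exact: ltW.
have [r rxE r0] : exists2 r : R, (rho : {measure set T1 -> \bar R}) [set x] = r%:E & 0 < r.
  have rxfin : rho [set x] \is a fin_num by exact: fin_num_measure.
  by exists (fine (rho [set x])); rewrite ?fineK// fine_gt0// rx ltey_eq rxfin.
have phiI : (\int[rho]_z phi z = 2^-1%:E * (\int[rho]_z phi0 z + \int[rho]_z phi1 z)
    + (del / 2 * r)%:E)%E.
  rewrite integralD// integralZl//; last exact: integrableD.
  rewrite integralD//; congr (_ + _)%E.
  under eq_integral do rewrite EFinM.
  rewrite integralZl//; last exact: integrable_indic.
  by rewrite integral_indic// setIT rxE.
have psiI : (\int[mu]_y psi y = 2^-1%:E * (\int[mu]_y psi0 y + \int[mu]_y psi1 y))%E.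
  rewrite -integralD// -integralZl//; last exact: integrableD.
  rewrite (integral_full mY muY ipsi) [RHS](integral_full mY muY ihalf).
  by apply: eq_integral => y /psiE.
(* The two optimal values coincide, and the raised midpoint exceeds them by [del / 2 * r]. *)
have := max0 _ _ opt1.1; have := max1 _ _ opt0.1; have := max0 _ _ adm.
rewrite /dual_value phiI psiI.
have := integrable_fin_num measurableT iphi0; move=> /fineK <-.
have := integrable_fin_num measurableT iphi1; move=> /fineK <-.
have := integrable_fin_num measurableT ipsi0; move=> /fineK <-.
have := integrable_fin_num measurableT ipsi1; move=> /fineK <-.
have : 0 < del / 2 * r by rewrite mulr_gt0 ?divr_gt0.
move: (fine _) (fine _) (fine _) (fine _) => p0 p1 q0 q1.
rewrite -?EFinD -?EFinM -?EFinD !lee_fin; lra.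
Qed.

End approximate_contact.

(** Subtract near-contact from admissibility at the same second argument: [y] for the first pair,
    [y'] for the second. Then [psi0 y] and [psi1 y'] cancel; the two-sided bounds force them to be
    finite. *)
Lemma potential_difference_le (d1 d2 : measure_display)
    (T1 : measurableType d1) (T2 : measurableType d2) (R : realType)
    (c : T1 -> T2 -> R) (phi0 phi1 : T1 -> \bar R) (psi0 psi1 : T2 -> \bar R)
    (x x' : T1) (y y' : T2) (del : R) :
  phi0 x \is a fin_num -> phi1 x \is a fin_num ->
  phi0 x' \is a fin_num -> phi1 x' \is a fin_num ->
  (phi0 x' + psi0 y <= (c x' y)%:E)%E -> (phi1 x + psi1 y' <= (c x y')%:E)%E ->
  ((c x y - del)%:E <= phi0 x + psi0 y)%E ->
  ((c x' y' - del)%:E <= phi1 x' + psi1 y')%E ->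
  (fine (phi0 x') - fine (phi1 x')) - (fine (phi0 x) - fine (phi1 x)) <=
  (c x' y - c x y) - (c x' y' - c x y') + 2 * del.
Proof.
move=> /fineK <- /fineK <- /fineK <- /fineK <-.
case: (psi0 y) (psi1 y') => [s| |] [t| |]//.
rewrite -!EFinD !lee_fin /=; lra.
Qed.

(** * Oscillation along lattice lines *)

Lemma scaled_latticeP (R : realType) (d : nat) (eps : R) (x : 'rV[R]_d) :
  scaled_lattice eps x <-> forall i, exists z : int, x ord0 i = eps * z%:~R.
Proof.
split=> [[z _ <-] i|/choice[z xz]]; first by exists (z ord0 i); rewrite !mxE.
by exists (\row_i z i) => //; apply/rowP => i; rewrite !mxE xz.
Qed.

Section lattice_oscillation.
Context (R : realType) (d : nat) (I : 'I_d -> set R) (eps D : R)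
  (Y : set 'rV[R]_d) (f : 'rV[R]_d -> R).
Let S := box I `&` @scaled_lattice R d eps.
Hypotheses (hI : forall i, is_interval (I i)) (eps0 : 0 < eps)
  (hD : forall y y', Y y -> Y y' -> forall i, `|y ord0 i - y' ord0 i| <= D)
  (hf : forall del, 0 < del -> exists y : 'rV[R]_d -> 'rV[R]_d,
    (forall x, S x -> Y (y x)) /\
    forall x x', S x -> S x' -> f x' - f x <=
      2 * (\sum_j (x' ord0 j - x ord0 j) * (y x' ord0 j - y x ord0 j))
      + 2 * del).

(* Along a lattice line the increments [2 * eps * (y_(k+1) - y_k)] telescope,
   so that the bound does not depend on the length of the line. *)
Let line x x' (i : 'I_d) : S x -> S x' ->
  (forall j, j != i -> x' ord0 j = x ord0 j) -> f x' - f x <= 2 * eps * D.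
Proof.
move=> Sx Sx' xx'.
have [bx /scaled_latticeP lx] := Sx; have [bx' /scaled_latticeP lx'] := Sx'.
have [z xz] := lx i; have [z' xz'] := lx' i.
(* [s] is the direction of travel and [n] the number of lattice steps, so one induction serves both
   orientations. *)
have [s [n [s1 zn]]] : exists (s : int) (n : nat),
    (s = 1 \/ s = -1) /\ z' = z + s * n%:Z.
  exists (if 0 <= z' - z then 1 else -1), `|z' - z|%N.
  split; first by case: ifP; [left|right].
  rewrite abszE; case: ifPn => [?|]; first by rewrite mul1r ger0_norm// subrKC.
  by rewrite -ltNge => ?; rewrite mulN1r ltr0_norm// opprK subrKC.
pose L k : 'rV[R]_d :=
  \row_j (if j == i then eps * (z + s * k%:Z)%:~R else x ord0 j).
have L0 : L 0%N = x.
  by apply/rowP => j; rewrite mxE mulr0 addr0; case: eqP => // ->.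
have Ln : L n = x'.
  by apply/rowP => j; rewrite mxE -zn; case: eqVneq => [->//|/xx' ->].
have SL k : (k <= n)%N -> S (L k).
  move=> kn; split.
    move=> j; rewrite mxE; case: eqVneq => [->|_]; last exact: bx.
    case: s1 => s1; rewrite s1 in zn *.
      apply: (hI (bx i) (bx' i)); rewrite xz xz' zn !ler_pM2l// !ler_int.
      by rewrite !mul1r lerDl lerD2l; apply/andP; split.
    apply: (hI (bx' i) (bx i)); rewrite xz xz' zn !ler_pM2l// !ler_int.
    by rewrite !mulN1r gerDl lerD2l lerN2 oppr_le0; apply/andP; split.
  apply/scaled_latticeP => j; rewrite mxE; case: eqVneq => _; last exact: lx.
  by exists (z + s * k%:Z).
(* Each step costs an error [2 * del]; [n] is fixed before [del], so the total error can be made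
   arbitrarily small. *)
have bound del : 0 < del -> f x' - f x <= 2 * eps * D + n%:R * (2 * del).
  move=> del0; have [y [Yy hy]] := hf del0.
  have tel k : (k <= n)%N -> f (L k) - f (L 0%N) <=
      2 * (s%:~R * eps) * (y (L k) ord0 i - y (L 0%N) ord0 i) + k%:R * (2 * del).
    elim: k => [_|k IH kn]; first by rewrite !subrr mulr0 mul0r addr0.
    have := hy _ _ (SL k (ltnW kn)) (SL k.+1 kn).
    rewrite (bigD1 i)//= big1 => [|j ji]; last by rewrite !mxE (negbTE ji) subrr mul0r.
    rewrite addr0 {1 2}/L !mxE eqxx -mulrBr -rmorphB/=.
    rewrite (_ : z + s * k.+1 - (z + s * k) = s); last by rewrite -(addn1 k) PoszD; ring.
    have := IH (ltnW kn); rewrite -(addn1 k) natrD.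
    lra.
  have := tel n (leqnn n); rewrite Ln L0 => /le_trans; apply.
  rewrite lerD2r -!mulrA ler_pM2l// mulrCA ler_pM2l//.
  have := hD (Yy _ Sx') (Yy _ Sx) i; rewrite ler_norml => /andP[? ?].
  by case: s1 => ->; rewrite ?mulrN1z ?mulr1z; lra.
(* Take [del] to be [r / (2 * n.+1)]; the successor keeps the denominator nonzero when [n] is 0. *)
apply/ler_addgt0Pr => r r0.
have n0 : 0 < 2 * n.+1%:R :> R by rewrite mulr_gt0.
apply: (le_trans (bound _ (divr_gt0 r0 n0))); rewrite lerD2l.
rewrite [X in _ * X](_ : _ = r / n.+1%:R); last by rewrite invfM mulrCA mulVKf ?pnatr_eq0.
by rewrite mulrCA ger_pMr// ler_pdivrMr// mul1r ler_nat.
Qed.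

(** Coordinates are exchanged one at a time: [w k] has its first [k] coordinates from [x'] and the
    others from [x]. It stays in [S] because box and lattice are both products, and each of the [d]
    exchanges is a move along one line. *)
Lemma lattice_oscillation x x' : S x -> S x' ->
  `|f x' - f x| <= 2 * d%:R * D * eps.
Proof.
wlog suff main : x x' / S x -> S x' -> f x' - f x <= 2 * d%:R * D * eps.
  move=> Sx Sx'; rewrite ler_norml; have := main _ _ Sx Sx'.
  by have := main _ _ Sx' Sx; lra.
move=> Sx Sx'.
pose w k : 'rV[R]_d := \row_j (if (j < k)%N then x' ord0 j else x ord0 j).
have Sw k : S (w k).
  have [bx /scaled_latticeP lx] := Sx; have [bx' /scaled_latticeP lx'] := Sx'.
  by split; [move=> j|apply/scaled_latticeP => j]; rewrite mxE; case: ifP.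
have tel k : (k <= d)%N -> f (w k) - f (w 0%N) <= k%:R * (2 * eps * D).
  elim: k => [_|k IH kd]; first by rewrite subrr mul0r.
  have : f (w k.+1) - f (w k) <= 2 * eps * D.
    apply: (@line _ _ (Ordinal kd)) => // j jk; rewrite !mxE ltnS leq_eqVlt.
    by rewrite -(inj_eq val_inj)/= in jk; rewrite (negbTE jk).
  by have := IH (ltnW kd); rewrite -(addn1 k) natrD; lra.
have := tel d (leqnn d).
rewrite (_ : w d = x'); last by apply/rowP => j; rewrite mxE ltn_ord.
rewrite (_ : w 0%N = x); last by apply/rowP => j; rewrite mxE.
lra.
Qed.

End lattice_oscillation.

(** * Euclidean norm, quadratic cost, Borel sets and supports *)

Section euclidean.
Context (R : realType) (d : nat).
Implicit Types (x y : 'rV[R]_d) (Y : set 'rV[R]_d).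

Lemma sqr_enorm x : enorm x ^+ 2 = \sum_i x ord0 i ^+ 2.
Proof. by rewrite sqr_sqrtr// sumr_ge0// => i _; exact: sqr_ge0. Qed.

Lemma sqdist_costE x y :
  sqdist_cost (x : borelRd R d) y = \sum_i (x ord0 i - y ord0 i) ^+ 2.
Proof. by rewrite /sqdist_cost sqr_enorm; under eq_bigr do rewrite !mxE. Qed.

Lemma le_coord_enorm x i : `|x ord0 i| <= enorm x.
Proof.
rewrite -sqrtr_sqr ler_wsqrtr// (bigD1 i)//= lerDl sumr_ge0// => j _.
exact: sqr_ge0.
Qed.

Lemma compact_coord_bounded Y : compact Y ->
  exists N : 'I_d -> R, forall i y, Y y -> `|y ord0 i| <= N i.
Proof.
move=> cY.
suff /choice[N YN] : forall i, exists N, forall y, Y y -> `|y ord0 i| <= N by exists N.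
move=> i; have : compact [set y ord0 i | y in Y].
  apply: continuous_compact => //; apply: continuous_subspaceT => y.
  exact: coord_continuous.
by move=> /compact_bounded/pinfty_ex_gt0[N _ YN]; exists N => y Yy; apply: YN; exists y.
Qed.

Lemma compact_sqr_enorm_bounded Y : compact Y ->
  exists M, forall y, Y y -> enorm y ^+ 2 <= M.
Proof.
move=> /compact_coord_bounded[N YN]; exists (\sum_i N i ^+ 2) => y Yy.
rewrite sqr_enorm; apply: ler_sum => i _.
have yN := YN i y Yy.
by rewrite -[leLHS]real_normK ?num_real// lerXn2r ?nnegrE//; exact: le_trans yN.
Qed.

(** Compactness supplies the upper bound without which the real supremum [ediam] takes its default
    value. *)
Lemma coord_le_ediam Y y y' i : compact Y -> Y y -> Y y' ->
  `|y ord0 i - y' ord0 i| <= ediam Y.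
Proof.
move=> cY Yy Yy'; have [N YN] := compact_coord_bounded cY.
apply: le_trans (_ : enorm (y - y') <= _).
  by have := le_coord_enorm (y - y') i; rewrite !mxE.
apply: ub_le_sup; last by exists (y, y').
exists (Num.sqrt (\sum_i (N i + N i) ^+ 2)) => _ [[z z'] [/= Yz Yz'] <-].
apply: ler_wsqrtr; apply: ler_sum => j _.
have le : `|z ord0 j - z' ord0 j| <= N j + N j.
  by apply: le_trans (ler_normB _ _) _; apply: lerD; exact: YN.
rewrite !mxE -[leLHS]real_normK ?num_real// lerXn2r ?nnegrE//.
exact: le_trans le.
Qed.

Lemma sqdist_cost_le x y :
  sqdist_cost (x : borelRd R d) y <= 2 * enorm x ^+ 2 + 2 * enorm y ^+ 2.
Proof.
rewrite sqdist_costE !sqr_enorm -mulrDr -big_split mulr_sumr/=.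
apply: ler_sum => i _; have := sqr_ge0 (x ord0 i + y ord0 i); nra.
Qed.

(** The squares cancel in the cross difference; the bilinear remainder is what telescopes along
    lattice lines. *)
Lemma sqdist_cost_cross x x' y y' :
  (sqdist_cost (x' : borelRd R d) y - sqdist_cost (x : borelRd R d) y) -
  (sqdist_cost (x' : borelRd R d) y' - sqdist_cost (x : borelRd R d) y') =
  2 * \sum_i (x' ord0 i - x ord0 i) * (y' ord0 i - y ord0 i).
Proof.
rewrite !sqdist_costE -!sumrB mulr_sumr; apply: eq_bigr => i _; ring.
Qed.

Lemma measurable_coord i :
  measurable_fun [set: borelRd R d] (fun x : borelRd R d => (x : 'rV[R]_d) ord0 i).
Proof.
apply: (measurability _ (RGenOInfty.measurableE R)) => //.
move=> _ [_ [r ->] <-]; rewrite setTI; apply: sub_sigma_algebra.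
have /continuousP := @coord_continuous R 1 d ord0 i; apply.
exact: interval_open.
Qed.

Lemma measurable_enorm2 :
  measurable_fun [set: borelRd R d] (fun x : borelRd R d => enorm (x : 'rV[R]_d) ^+ 2).
Proof.
under eq_fun do rewrite sqr_enorm.
apply: measurable_sum => i; apply: measurable_funX; exact: measurable_coord.
Qed.

Lemma measurable_sqdist_cost (x : borelRd R d) :
  measurable_fun [set: borelRd R d] (sqdist_cost x).
Proof.
have -> : sqdist_cost x = fun y : borelRd R d =>
    \sum_i ((x : 'rV[R]_d) ord0 i - (y : 'rV[R]_d) ord0 i) ^+ 2.
  by apply/funext => y; exact: sqdist_costE.
apply: measurable_sum => i; apply: measurable_funX; apply: measurable_funB => //.
exact: measurable_coord.
Qed.

Lemma closed_measurable_borelRd (A : set 'rV[R]_d) :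
  closed A -> measurable (A : set (borelRd R d)).
Proof.
move=> cA; rewrite -[A]setCK; apply: measurableC; apply: sub_sigma_algebra.
exact: closed_openC.
Qed.

Lemma compact_measurable_borelRd (A : set 'rV[R]_d) :
  compact A -> measurable (A : set (borelRd R d)).
Proof.
by move=> cA; apply: closed_measurable_borelRd; apply: compact_closed cA; exact: norm_hausdorff.
Qed.

Lemma measurable_set1_borelRd (x : borelRd R d) : measurable [set x].
Proof.
have := @compact_set1 'rV[R]_d x.
exact: compact_measurable_borelRd.
Qed.

Lemma measurable_spt (rho : probability (borelRd R d) R) :
  measurable (spt rho : set (borelRd R d)).
Proof.
rewrite -[spt rho]setCK; apply: measurableC; apply: sub_sigma_algebra => /=.
rewrite openE => x /= /existsNP[U /not_implyP[[oU Ux] rU]].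
by apply: (@filterS _ _ _ U); [by move=> z Uz /(_ U (conj oU Uz))|exact: open_nbhs_nbhs].
Qed.

(* Every point off the support lies in a null ball of rational centre and
   radius. *)
Lemma spt_full (rho : probability (borelRd R d) R) : rho (spt rho) = 1%E.
Proof.
pose Q (q : 'rV[rat]_d * nat) : set 'rV[R]_d := ball (map_mx ratr q.1 : 'rV[R]_d) q.2.+1%:R^-1.
pose F n : set (borelRd R d) := match unpickle n with
  | Some q => if `[< rho.-negligible (Q q) >] then Q q else set0
  | None => set0 end.
have F0 n : rho.-negligible (F n).
  rewrite /F; case: unpickle => [q|]; last exact: negligible_set0.
  by case: asboolP => // _; exact: negligible_set0.
have : rho.-negligible (~` spt rho).
  apply: negligibleS (negligible_bigcup F0) => x.
  move=> /existsNP[U /not_implyP[[oU Ux] rU]].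
  have U0 : rho U = 0%E.
    by apply/eqP; rewrite -measure_le0 leNgt; apply/negP.
  have /nbhs_ballP[r /= r0 rU'] : nbhs x U by exact: open_nbhs_nbhs.
  (* With radius below [r / 2] and a centre closer to [x] than that radius, the rational ball
     contains [x] and lies in the ball of radius [r] about [x]. Balls are those of the sup norm, so
     the centre is chosen coordinatewise. *)
  have [k kr] : exists k : nat, k.+1%:R^-1 < r / 2.
    have /filter_ex[k] := near_infty_natSinv_lt (PosNum (divr_gt0 r0 (ltr0Sn R 1))).
    by exists k.
  have k0 : 0 < k.+1%:R^-1 :> R by rewrite invr_gt0.
  have /choice[q xq] : forall i, exists q : rat, `|ratr q - x ord0 i| < k.+1%:R^-1.
    move=> i; have lt : x ord0 i < x ord0 i + k.+1%:R^-1 by rewrite ltrDl.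
    have [q] := rat_in_itvoo lt.
    rewrite in_itv/= => /andP[xq qx]; exists q.
    by rewrite gtr0_norm ?subr_gt0// ltrBlDl.
  pose qk := (\row_i q i, k) : 'rV[rat]_d * nat.
  exists (pickle qk) => //; rewrite /F pickleK asboolT.
    by split => // i j; rewrite !mxE (ord1 i) -ball_normE; exact: xq.
  exists U; split => //; first exact: sub_sigma_algebra.
  move=> z [_ qz]; apply: rU'; split => // i j.
  have := qz i j; rewrite !mxE -!ball_normE /= (ord1 i) => ?.
  have := xq j; rewrite distrC => ?.
  apply: le_lt_trans (ler_distD (ratr (q j)) _ _) _.
  by rewrite (splitr r) ltrD//; apply: lt_trans kr.
have mC := measurableC (measurable_spt rho).
move=> /(measure_negligible mC) C0.
have := probability_setC rho mC; rewrite setCK => ->.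
by rewrite [X in (_ - X)%E]C0 sube0.
Qed.

(** A ball about [x] has positive mass, all of it on the support by [spt_full], and meets the
    support only at [x]. *)
Lemma spt_isolated_atom (rho : probability (borelRd R d) R) (x : borelRd R d) r :
  0 < r -> spt rho x ->
  (forall z, spt rho z -> (forall i, `|x ord0 i - z ord0 i| < r) -> z = x) ->
  (0 < rho [set x])%E.
Proof.
move=> r0 Sx iso.
pose U : set 'rV[R]_d := (ball (x : 'rV[R]_d) r)°.
have oU : open_nbhs (x : 'rV[R]_d) U.
  by split; [exact: open_interior|exact: nbhsx_ballx].
apply: lt_le_trans (Sx _ oU) _.
have mU : measurable (U : set (borelRd R d)) by apply: sub_sigma_algebra; exact: open_interior.
have mS := measurable_spt rho.
have -> : rho U = rho (U `&` spt rho).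
  rewrite -[in LHS](setUIDK U (spt rho)) measureU//.
  - rewrite [X in (_ + X)%E](_ : _ = 0%E) ?adde0//.
    apply/eqP; rewrite -measure_le0.
    apply: (@le_trans _ _ (rho (~` spt rho))).
      apply: le_measure; rewrite ?inE; [exact: measurableD|exact: measurableC|].
      by move=> z [].
    by rewrite probability_setC// spt_full subee.
  - exact: measurableI.
  - exact: measurableD.
  - by apply/seteqP; split => // z [[? ?] [? ?]].
apply: le_measure; rewrite ?inE; [exact: measurableI|exact: measurable_set1_borelRd|].
move=> z [/interior_subset [_ xz] Sz]; apply: iso => // i.
by have := xz ord0 i; rewrite -ball_normE.
Qed.

End euclidean.

Lemma spt_lattice_atom (R : realType) (d : nat) (A : set 'rV[R]_d)
    (rho : probability (borelRd R d) R) (eps : R) (x : borelRd R d) :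
  0 < eps -> spt rho = A `&` @scaled_lattice R d eps -> spt rho x ->
  (0 < rho [set x])%E.
Proof.
move=> eps0 hspt Sx; apply: (spt_isolated_atom eps0 Sx) => z Sz xz.
move: Sx Sz; rewrite hspt => -[_ /scaled_latticeP lx] [_ /scaled_latticeP lz].
apply/rowP => i; have := xz i; have [n ->] := lx i; have [m ->] := lz i.
(* Two coordinates closer than [eps] have integer factors differing by less than 1, hence equal
   ones. *)
rewrite -mulrBr normrM gtr0_norm// gtr_pMr// -rmorphB/= -intr_norm ltrz1 => nm.
by congr (_ * _%:~R); move: nm; lia.
Qed.

(** * From almost-everywhere bounds to the diameter, and the theorem *)

Lemma diam_Linfty_le (disp : measure_display) (T : measurableType disp)
    (R : realType) (rho : probability T R) (Phi : set (T -> \bar R)) (r : R) :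
  (forall phi0 phi1, Phi phi0 -> Phi phi1 -> exists l : R,
    {ae rho, forall x, (`|phi0 x - phi1 x - l%:E| <= r%:E)%E}) ->
  (diam_Linfty rho Phi <= r%:E)%E.
Proof.
move=> H; apply: ge_ereal_sup => _ [[phi0 phi1] [/= Phi0 Phi1] <-].
have [l Hl] := H _ _ Phi0 Phi1.
apply: ge_ereal_inf; eexists; first by exists l.
have rT : (0 < rho [set: T])%E by rewrite probability_setT lte01.
by rewrite unlock ifT//; exact/ess_supP.
Qed.

Unset Implicit Arguments.

Theorem theorem1p7 (R : realType) (d : nat) (I : 'I_d -> set R)
    (hI : forall i, is_interval (I i))
    (Y : set 'rV[R]_d) (hY : compact Y)
    (rho : probability (borelRd R d) R) (hrho : finite_second_moment rho)
    (eps : R) (heps : 0 < eps)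
    (hspt : spt rho = box I `&` @scaled_lattice R d eps)
    (mu : probability (borelRd R d) R) (hmu : mu Y = 1%E) :
  let Phi := kantorovich_potentials (@sqdist_cost R d) rho mu in
  let C := 2 * d%:R * ediam Y in
  Phi !=set0 /\ (diam_Linfty rho Phi <= (C * eps)%:E)%E.
Proof.
move=> Phi C.
have m1 := @measurable_set1_borelRd R d.
have mY := compact_measurable_borelRd hY.
have atom x := @spt_lattice_atom _ _ _ _ _ x heps hspt.
have rhoS := spt_full rho.
have mS := measurable_spt rho.
have [x0 Sx0] : exists x0, spt rho x0.
  apply/set0P/eqP => S0; move: rhoS; rewrite S0 measure0 => /eqP.
  by rewrite eq_sym onee_eq0.
split.
  (* Naturals are decoded as integer vectors; the default [x0] keeps the enumeration inside the
     support. *)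
  pose e n : borelRd R d := if unpickle n is Some z then
    let x := eps *: map_mx intr (z : 'rV[int]_d) in
    if x \in spt rho then x else x0 else x0.
  have eS : range e = spt rho.
    apply/seteqP; split => [_ [n _ <-]|x Sx].
      by rewrite /e; case: unpickle => // z /=; case: ifP => //; rewrite inE.
    have := Sx; rewrite hspt => -[_ [z _ zx]]; exists (pickle z) => //.
    by rewrite /e pickleK /= zx mem_set.
  have [M YM] := compact_sqr_enorm_bounded hY.
  have ienorm : rho.-integrable [set: borelRd R d]
      (fun x => (enorm (x : 'rV[R]_d) ^+ 2)%:E).
    apply/integrableP; split; first by apply/measurable_EFinP; exact: measurable_enorm2.
    apply: le_lt_trans hrho; rewrite le_eqVlt; apply/orP; left; apply/eqP.
    by apply: eq_integral => x _; rewrite gee0_abs// lee_fin sqr_ge0.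
  apply: (@kantorovich_potentials_nonempty _ _ _ _ _ rho mu _
    (fun x => 2 * enorm (x : 'rV[R]_d) ^+ 2 + 2 * M) Y e x0) => //.
  - by rewrite eS.
  - by rewrite eS.
  - exact: atom.
  - exact: measurable_sqdist_cost.
  - by move=> x y; exact: sqr_ge0.
  - move=> x y Yy; apply: le_trans (sqdist_cost_le x y) _.
    by rewrite lerD2l ler_pM2l//; exact: YM.
  - rewrite (_ : _ \o _ =
      (fun x => 2%:E * (enorm (x : 'rV[R]_d) ^+ 2)%:E + cst (2 * M)%:E x)%E).
      apply: integrableD => //; first exact: integrableZl.
      exact: (finite_measure_integrable_cst rho).
    by apply/funext => x /=; rewrite EFinD EFinM.
apply: diam_Linfty_le => phi0 phi1 [L0 [psi0 [_ opt0]]] [L1 [psi1 [_ opt1]]].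
have fin0 x : spt rho x -> phi0 x \is a fin_num.
  by move=> Sx; exact: L1_atom_fin_num (m1 x) (atom x Sx) L0.
have fin1 x : spt rho x -> phi1 x \is a fin_num.
  by move=> Sx; exact: L1_atom_fin_num (m1 x) (atom x Sx) L1.
pose f (x : 'rV[R]_d) := fine (phi0 x) - fine (phi1 x).
have hf del : 0 < del -> exists y : 'rV[R]_d -> 'rV[R]_d,
    (forall x, spt rho x -> Y (y x)) /\
    forall x x', spt rho x -> spt rho x' -> f x' - f x <=
      2 * (\sum_j (x' ord0 j - x ord0 j) * (y x' ord0 j - y x ord0 j)) + 2 * del.
  move=> del0.
  have /choice[y Hy] : forall x : borelRd R d, exists y, spt rho x ->
      [/\ Y y, ((sqdist_cost x y - del)%:E <= phi0 x + psi0 y)%E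
        & ((sqdist_cost x y - del)%:E <= phi1 x + psi1 y)%E].
    move=> x; have [Sx|] := pselect (spt rho x); last by exists 0.
    have [y ?] := approximate_contact mY hmu opt0 opt1 (m1 x) (atom x Sx) del0.
    by exists y.
  exists y; split=> [x /Hy[]//|x x' Sx Sx'].
  have [_ c0 _] := Hy x Sx; have [_ _ c1] := Hy x' Sx'.
  have [[_ _ adm0] _] := opt0; have [[_ _ adm1] _] := opt1.
  rewrite -sqdist_cost_cross.
  exact: (potential_difference_le (fin0 _ Sx) (fin1 _ Sx) (fin0 _ Sx')
    (fin1 _ Sx') (adm0 _ _) (adm1 _ _) c0 c1).
(* Subtracting the value of [f] at a base point turns the oscillation bound into a bound on the
   norm. *)
exists (f x0); apply: (ae_full mS rhoS) => x Sx.
rewrite -(fineK (fin0 _ Sx)) -(fineK (fin1 _ Sx)) -!EFinB lee_fin.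
have hD y y' : Y y -> Y y' -> forall i, `|y ord0 i - y' ord0 i| <= ediam Y.
  by move=> Yy Yy' i; exact: coord_le_ediam.
rewrite hspt in hf Sx Sx0.
exact: (lattice_oscillation hI heps hD hf Sx0 Sx).
Qed.
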